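(* Let $p\in[0,1/2)$ and suppose the true position $L^*$ is uniformly distributed on $[n]$. For any variable-length noisy searching scheme with error probability $\tilde P_e=\mathbb{P}(\hat L\ne L^* )$, the expected number of queries satisfies $$\mathbb{E}[\tilde M]>\frac{\log_2 n}{1-H(p)}+\frac{\log_2\frac{1}{\tilde P_e}}{D(p\|1-p)}-\frac{\log_2\log_2\frac{n}{\tilde P_e}}{D(p\|1-p)}-\frac{\tilde P_e\log_2 n}{1-H(p)}+O(1).$$
   Context: Noisy searching problem: given sorted reals $\tilde\theta_0=-\infty<\tilde\theta_1<\cdots<\tilde\theta_{n-1}<\tilde\theta_n=+\infty$ and a target $\tilde\theta$, the true position is the index $l^*\in[n]$ with $\tilde\theta_{l^*-1}<\tilde\theta<\tilde\theta_{l^*}$. At step $k$ the agent queries $\tilde U_k\in\{\tilde\theta_1,\ldots,\tilde\theta_{n-1}\}$ and receives $\tilde Y_k=\mathbb{1}_{\{\tilde U_k<\tilde\theta\}}\oplus\tilde Z_k$, with $\tilde Z_k$ i.i.d. $\mathrm{Bern}(p)$. A variable-length noisy searching scheme consists of a causal adaptive querying strategy $\tilde U_k=\tilde f_k(\tilde Y^{k-1},\tilde U^{k-1})$, a stopping time $\tilde M$ (number of queries, possibly depending on responses), and an estimator $\hat L=\hat l(\tilde Y^{\tilde M},\tilde U^{\tilde M})$. $H(p)=-p\log_2p-(1-p)\log_2(1-p)$, $D(p\|1-p)=p\log_2\frac{p}{1-p}+(1-p)\log_2\frac{1-p}{p}$. $O(1)$ denotes a term bounded by a constant not depending on $n$ or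 $\tilde P_e$. *)

(* Defs.v *)
From mathcomp Require Import all_boot all_order all_algebra.
From mathcomp Require Import all_classical all_reals all_analysis.

Set Implicit Arguments.
Unset Strict Implicit.
Unset Printing Implicit Defensive.

Import Order.TTheory GRing.Theory Num.Theory.
Local Open Scope ring_scope.

(* Positions: l : 'I_n stands for the position l+1 in [n] (0-indexed).
   Queries:   u : 'I_n.-1 stands for the query point theta_{u+1}
              (queries range over theta_1, ..., theta_{n-1}).
   The noiseless answer 1{theta_{u+1} < theta} with theta in
   (theta_l, theta_{l+1}) (0-indexed l) is exactly (u < l). *)

(* A (deterministic) variable-length noisy searching scheme:
   - [query ys us] is the next query given past responses ys and past
     queries us (causal adaptive strategy f_k, k = size ys + 1);
   - [stop ys us] decides to stop after having observed the history
     (ys, us) (so the stopping time M is a stopping time of the history);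
   - [est ys us] is the estimate of the position at the stopping time. *)
Record scheme (n : nat) := Scheme {
  query : seq bool -> seq 'I_n.-1 -> 'I_n.-1;
  stop  : seq bool -> seq 'I_n.-1 -> bool;
  est   : seq bool -> seq 'I_n.-1 -> 'I_n }.

Fixpoint queries_aux n (f : seq bool -> seq 'I_n.-1 -> 'I_n.-1)
    (py : seq bool) (pu : seq 'I_n.-1) (ys : seq bool) : seq 'I_n.-1 :=
  match ys with
  | [::] => pu
  | y :: ys' => queries_aux f (rcons py y) (rcons pu (f py pu)) ys'
  end.

Definition queries n (S : scheme n) (ys : seq bool) : seq 'I_n.-1 :=
  queries_aux (query S) [::] [::] ys.

Definition stops_at n (S : scheme n) (ys : seq bool) : bool :=
  let us := queries S ys in
  stop S ys us &&
  all (fun i => ~~ stop S (take i ys) (take i us)) (iota 0 (size ys)).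

(* Probability that the first size ys responses equal ys, given L* = l:
   each response is Y_k = 1{U_k < theta} xor Z_k with Z_k iid Bern(p). *)
Definition path_prob (R : realType) n (p : R) (S : scheme n) (l : 'I_n)
    (ys : seq bool) : R :=
  \prod_(yu <- zip ys (queries S ys))
     (if yu.1 == (val yu.2 < val l)%N then 1 - p else p).

Definition probM (R : realType) n (p : R) (S : scheme n) (k : nat) : R :=
  n%:R^-1 * \sum_(l : 'I_n) \sum_(ys : k.-tuple bool | stops_at S ys)
     path_prob p S l ys.

Definition probErr (R : realType) n (p : R) (S : scheme n) (k : nat) : R :=
  n%:R^-1 * \sum_(l : 'I_n)
     \sum_(ys : k.-tuple bool | stops_at S ys && (est S ys (queries S ys) != l))
     path_prob p S l ys.

Definition probFinite (R : realType) n (p : R) (S : scheme n) : R :=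
  limn (fun N => \sum_(k < N) probM p S k).

Definition Perr (R : realType) n (p : R) (S : scheme n) : R :=
  limn (fun N => \sum_(k < N) probErr p S k).

Definition expM (R : realType) n (p : R) (S : scheme n) : \bar R :=
  (\sum_(k <oo) ((k%:R * probM p S k)%:E))%E.

Definition log2 (R : realType) (x : R) : R := ln x / ln 2.

(* binary entropy, with the convention 0 log 0 = 0 (ln 0 = 0 in the library) *)
Definition Hb (R : realType) (p : R) : R :=
  - p * log2 p - (1 - p) * log2 (1 - p).

Definition Dpq (R : realType) (p : R) : R :=
  p * log2 (p / (1 - p)) + (1 - p) * log2 ((1 - p) / p).

(* 1 / D(p || 1-p), with D(0 || 1) = +oo so that 1/D = 0 at p = 0 *)
Definition invD (R : realType) (p : R) : R :=
  if p == 0 then 0 else (Dpq p)^-1.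

(* Main.v *)
Require Import Defs.
From mathcomp Require Import all_boot all_order all_algebra.
From mathcomp Require Import all_classical all_reals all_analysis.
From mathcomp Require Import ring lra.
Import Order.TTheory GRing.Theory Num.Theory.
Local Open Scope ring_scope.

(** Burnashev's potential argument. Let [m] be the joint weight of the position
    and of the responses seen so far, [H] the posterior entropy and
    [g = 1 - sum pi_l ^ 2] the posterior collision deficit. One query lowers
    [E H] by at most the capacity [ln 2 - h(p)], and lowers [E ln g] by at most
    the divergence [D(p || 1 - p)]. The potential is [H / capacity] while
    [g * log2 n >= 1] (unless the second branch is larger), and
    [ln (g * log2 n) / D + const] afterwards. As [H <= ln 2 + g * ln n] and one
    query shrinks [g] at most by the factor [p ^ 2], the constant can be chosen
    so that the potential still drops by at most 1 per query on average, hence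
    [E M] is at least its initial value [ln n / capacity] minus its mean at the
    end. Since [g <= 2 * error], tangents of [ln] and Fano's inequality bound
    the latter by [(ln Perr + ln (log2 n)) / D + Perr * ln n / capacity + O(1)].
    To avoid limits of the potential, the tree is truncated at a depth
    by which the scheme has stopped with probability close to 1. *)

(** * Convexity inequalities for [ln] and [x ln x], and the drift of a two-point prior *)

Section LogInequalities.
Context {R : realType}.
Implicit Types a b p q r s t x y : R.

Lemma ln_tangent s t : 0 < s -> 0 < t -> ln t <= ln s + t / s - 1.
Proof.
move=> s0 t0.
have ts0 : 0 < t / s by rewrite divr_gt0.
have : ln (1 + (t / s - 1)) <= t / s - 1 by apply: le_ln1Dx; lra.
rewrite addrC subrK ln_div ?posrE//; lra.
Qed.

(** This is [ln_tangent] with [s] and [t] exchanged, times [t]. The value [t = 0] is covered because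
    [0 * ln 0 = 0]. *)
Lemma xlnx_tangent s t : 0 < s -> 0 <= t -> t * ln s + t - s <= t * ln t.
Proof.
move=> s0; rewrite le_eqVlt => /predU1P[<-|t0]; first by rewrite !mul0r; lra.
have := @ln_tangent t s t0 s0.
rewrite -(ler_pM2l t0) mulrBr mulrDr mulr1 mulrCA divff ?gt_eqF// mulr1; lra.
Qed.

Lemma xlnx_convex x a b : 0 <= x <= 1 -> 0 < a -> 0 < b ->
  (x * a + (1 - x) * b) * ln (x * a + (1 - x) * b)
  <= x * (a * ln a) + (1 - x) * (b * ln b).
Proof.
move=> /andP[x0 x1] a0 b0; set s := x * a + _.
have s0 : 0 < s by rewrite /s; nra.
have Ha := @xlnx_tangent s a s0 (ltW a0).
have Hb := @xlnx_tangent s b s0 (ltW b0).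
have x1' : 0 <= 1 - x by lra.
have := lerD (ler_wpM2l x0 Ha) (ler_wpM2l x1' Hb).
apply: le_trans; rewrite le_eqVlt; apply/orP; left; apply/eqP.
rewrite /s; ring.
Qed.

Lemma ln_concave x a b : 0 <= x <= 1 -> 0 < a -> 0 < b ->
  x * ln a + (1 - x) * ln b <= ln (x * a + (1 - x) * b).
Proof.
move=> /andP[x0 x1] a0 b0; set s := x * a + _.
have s0 : 0 < s by rewrite /s; nra.
have Ha := @ln_tangent s a s0 a0.
have Hb := @ln_tangent s b s0 b0.
have x1' : 0 <= 1 - x by lra.
have := lerD (ler_wpM2l x0 Ha) (ler_wpM2l x1' Hb).
have -> : x * (ln s + a / s - 1) + (1 - x) * (ln s + b / s - 1)
  = ln s + (s / s - 1) by rewrite /s; field; rewrite gt_eqF.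
by rewrite divff ?gt_eqF// subrr addr0.
Qed.

(** Take the tangent of [ln] at [a i * B / A], with [A] and [B] the two sums: the correction terms
    [b i * A / B - a i] add up to 0. *)
Lemma log_sum (I : finType) (i0 : I) (a b : I -> R) :
  (forall i, 0 < a i) -> (forall i, 0 < b i) ->
  \sum_i a i * (ln (b i) - ln (a i))
  <= (\sum_i a i) * (ln (\sum_i b i) - ln (\sum_i a i)).
Proof.
move=> a0 b0; set A := \sum_i a i; set B := \sum_i b i.
have A0 : 0 < A by rewrite /A (bigD1 i0)//= ltr_wpDr// sumr_ge0// => i _; exact: ltW.
have B0 : 0 < B by rewrite /B (bigD1 i0)//= ltr_wpDr// sumr_ge0// => i _; exact: ltW.
have H i : a i * (ln (b i) - ln (a i)) <=
    a i * (ln B - ln A) + (b i * (A / B) - a i).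
  have AB0 : 0 < a i * B / A by rewrite divr_gt0// mulr_gt0.
  have := @ln_tangent (a i * B / A) (b i) AB0 (b0 i).
  rewrite ln_div ?posrE ?mulr_gt0// lnM ?posrE// -(ler_pM2l (a0 i)).
  have -> : a i * (ln (a i) + ln B - ln A + b i / (a i * B / A) - 1) =
    a i * ln (a i) + (a i * (ln B - ln A) + (b i * (A / B) - a i)).
    by field; rewrite !gt_eqF.
  rewrite mulrBr; lra.
apply: (le_trans (ler_sum _ (fun i _ => H i))).
rewrite big_split/= -mulr_suml -/A sumrB -mulr_suml -/B -/A.
by rewrite mulrCA divff ?gt_eqF// mulr1 subrr addr0.
Qed.

(** The left side is KL(P, 1-p) + KL(P, v) for Bernoulli laws, where [P] mixes [1 - p] and [v]. With
    [D] the right side, convexity bounds the first term by [(1 - s) * D] and the second by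
    [x * (1 - t) * D]. Since [1 - s = (1 - x) * (1 - t)], the total is [(1 - t) * D]. *)
Lemma two_point_drift p x v : 0 < p < 2^-1 -> 0 <= x <= 1 -> p <= v <= 1 - p ->
  let P := x * (1 - p) + (1 - x) * v in
  P * (2 * ln P - ln (1 - p) - ln v)
  + (1 - P) * (2 * ln (1 - P) - ln p - ln (1 - v))
  <= (1 - 2 * p) * (ln (1 - p) - ln p).
Proof.
move=> /andP[p0 p2] /andP[x0 x1] /andP[pv vq]; cbv zeta; set P := x * (1 - p) + _.
pose t := (v - p) / (1 - 2 * p).
have d0 : 0 < 1 - 2 * p by lra.
have t0 : 0 <= t by rewrite divr_ge0//; lra.
have t1 : t <= 1 by rewrite ler_pdivrMr//; lra.
have vE : v = t * (1 - p) + (1 - t) * p by rewrite /t; field; lra.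
have vE' : 1 - v = t * p + (1 - t) * (1 - p) by rewrite vE; ring.
(* Both [v] and [P] are mixtures of [1 - p] and [p], with weights [t] and [s] on [1 - p]. *)
pose s := x + (1 - x) * t.
have s0 : 0 <= s by rewrite /s; nra.
have s1 : s <= 1 by rewrite /s; nra.
have t01 : 0 <= t <= 1 by rewrite t0.
have s01 : 0 <= s <= 1 by rewrite s0.
have x01 : 0 <= x <= 1 by rewrite x0.
have q0 : 0 < 1 - p by lra.
have v0 : 0 < v by lra.
have v0' : 0 < 1 - v by lra.
have P1 : P = s * (1 - p) + (1 - s) * p by rewrite /P vE /s; ring.
have P1' : 1 - P = s * p + (1 - s) * (1 - p) by rewrite P1; ring.
have P2' : 1 - P = x * p + (1 - x) * (1 - v) by rewrite /P; ring.
have h1 := @xlnx_convex s _ _ s01 q0 p0; rewrite -P1 in h1.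
have h1' := @xlnx_convex s _ _ s01 p0 q0; rewrite -P1' in h1'.
have h2 := @xlnx_convex x _ _ x01 q0 v0; rewrite -/P in h2.
have h2' := @xlnx_convex x _ _ x01 p0 v0'; rewrite -P2' in h2'.
have h3 := @ln_concave t _ _ t01 q0 p0; rewrite -vE in h3.
have h3' := @ln_concave t _ _ t01 p0 q0; rewrite -vE' in h3'.
have L0 : 0 <= ln (1 - p) - ln p by rewrite subr_ge0 ler_ln ?posrE//; lra.
have sq : 0 <= x * (1 - p) by rewrite mulr_ge0// ltW.
have sp : 0 <= x * p by rewrite mulr_ge0// ltW.
have h4 := ler_wpM2l sq h3.
have h4' := ler_wpM2l sp h3'.
have h5 : 0 <= t * ((1 - 2 * p) * (ln (1 - p) - ln p)).
  by rewrite mulr_ge0// mulr_ge0// ltW.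
clearbody P.
move: (ln P) (ln (1 - P)) (ln v) (ln (1 - v)) (ln p) (ln (1 - p))
  h1 h1' h2 h2' h4 h4' h5 => lP lP' lv lv' lp lq h1 h1' h2 h2' h4 h4' h5.
have E1 : P * (2 * lP - lq - lv) + (1 - P) * (2 * lP' - lp - lv') =
  P * lP + (1 - P) * lP' + (P * lP + (1 - P) * lP') - P * lq - (1 - P) * lp
  - P * lv - (1 - P) * lv' by ring.
rewrite E1.
have -> : P * lv = x * (1 - p) * lv + (1 - x) * (v * lv).
  by rewrite P1 vE /s; ring.
have -> : (1 - P) * lv' = x * p * lv' + (1 - x) * ((1 - v) * lv').
  by rewrite P2'; ring.
have E2 : P * lq = (s * (1 - p) + (1 - s) * p) * lq by rewrite -P1.
have E3 : (1 - P) * lp = (s * p + (1 - s) * (1 - p)) * lp by rewrite -P1'.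
rewrite E2 E3.
move: (lerD (lerD (lerD h1 h1') (lerD h2 h2')) (lerD (lerD h4 h4') h5)).
move: (P * lP) ((1 - P) * lP') => A A'.
clear. rewrite /s. move: (v * lv) (x * p * lv') (x * (1 - p) * lv) => B B' B''.
move: ((1 - v) * lv') => B3. lra.
Qed.

(** This is [two_point_drift] scaled by [a + r]: [a] weighs one position, [r] all the others, and
    [r1], [r0] are the shares of [r] after each answer. *)
Lemma coordinate_drift p a r r1 r0 : 0 < p < 2^-1 -> 0 < a -> 0 < r ->
  r1 + r0 = r -> p * r <= r1 <= (1 - p) * r ->
  let w1 := a * (1 - p) + r1 in let w0 := a * p + r0 in
  w1 * (2 * ln w1 - ln (a * (1 - p) * r1)) + w0 * (2 * ln w0 - ln (a * p * r0))
  <= (a + r) * (2 * ln (a + r) - ln (a * r)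
                + (1 - 2 * p) * (ln (1 - p) - ln p)).
Proof.
move=> p01 a0 r0' rE /andP[r1l r1u]; cbv zeta.
set w1 := a * (1 - p) + _; set w0 := a * p + _.
have /andP[p0 p2] := p01.
pose w := a + r; pose x := a / w; pose v := r1 / r.
have w_gt0 : 0 < w by rewrite /w; lra.
have r1_gt0 : 0 < r1 by apply: lt_le_trans r1l; rewrite mulr_gt0.
have r0_gt0 : 0 < r0 by nra.
have x01 : 0 <= x <= 1.
  by rewrite /x ler_pdivrMr// mul1r /w divr_ge0/=; lra.
have v01 : p <= v <= 1 - p by rewrite /v ler_pdivlMr// ler_pdivrMr// r1l r1u.
have := @two_point_drift p x v p01 x01 v01.
set P := x * _ + _ => /= H.
have PE : P = w1 / w by rewrite /P /x /v /w1 /w; field; rewrite ?gt_eqF.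
have P'E : 1 - P = w0 / w.
  by rewrite PE /w1 /w0 /w -rE; field; rewrite rE gt_eqF.
have vE : 1 - v = r0 / r by rewrite /v -rE; field; rewrite rE gt_eqF.
have w1_gt0 : 0 < w1 by rewrite /w1; nra.
have w0_gt0 : 0 < w0 by rewrite /w0; nra.
move: H; rewrite P'E PE vE /v -(ler_pM2l w_gt0).
have q_gt0 : 0 < 1 - p by lra.
rewrite !ln_div ?lnM ?posrE ?mulr_gt0//.
have wwE : w1 + w0 = w by rewrite /w1 /w0 /w -rE; ring.
have -> : forall u1 u2, w * (w1 / w * u1 + w0 / w * u2) = w1 * u1 + w0 * u2.
  by move=> u1 u2; field; rewrite gt_eqF.
move=> H.
rewrite -subr_ge0; move: H; rewrite -subr_ge0; congr (0 <= _).
rewrite -/w -wwE; ring.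
Qed.

End LogInequalities.

(** * Unnormalized posteriors *)

Section Measures.
Context {R : realType} {I : finType}.
Implicit Types (m : I -> R) (c : I -> bool) (p : R).

Definition mass m : R := \sum_i m i.

(** [mass m] times the Shannon entropy, in nats, of the normalized posterior. *)
Definition entropy m : R := mass m * ln (mass m) - \sum_i m i * ln (m i).

(** [mass m ^+ 2] times the collision deficit of the normalized posterior. *)
Definition gini m : R := \sum_i m i * (mass m - m i).

(** Bayes' rule without normalization: [c i] is the noiseless answer at position [i]. Keeping joint
    weights makes expectations plain sums. *)
Definition update p c (y : bool) m : I -> R :=
  fun i => m i * (if y == c i then 1 - p else p).

Lemma mass_ge0 m : (forall i, 0 <= m i) -> 0 <= mass m.
Proof. by move=> m0; exact: sumr_ge0. Qed.

Lemma mass_gt0 m (i : I) : (forall i, 0 < m i) -> 0 < mass m.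
Proof.
by move=> m0; rewrite /mass (bigD1 i)//= ltr_wpDr// sumr_ge0// => j _; exact: ltW.
Qed.

Lemma le_mass m i : (forall i, 0 <= m i) -> m i <= mass m.
Proof. by move=> m0; rewrite /mass (bigD1 i)//= lerDl sumr_ge0. Qed.

Lemma mass_eq0 m i : (forall i, 0 <= m i) -> mass m = 0 -> m i = 0.
Proof.
by move=> m0 mm; apply/eqP; rewrite eq_le m0 andbT -mm; exact: le_mass.
Qed.

Lemma mass_update p c m :
  mass (update p c true m) + mass (update p c false m) = mass m.
Proof.
by rewrite /mass -big_split/=; apply: eq_bigr => i _;
  rewrite /update; case: (c i) => /=; ring.
Qed.

Lemma update_ge0 p c y m : 0 <= p < 2^-1 -> (forall i, 0 <= m i) ->
  forall i, 0 <= update p c y m i.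
Proof.
by move=> /andP[p0 p2] m0 i; rewrite /update mulr_ge0//; case: ifP => // _; lra.
Qed.

Lemma update_gt0 p c y m : 0 < p < 2^-1 -> (forall i, 0 < m i) ->
  forall i, 0 < update p c y m i.
Proof.
by move=> /andP[p0 p2] m0 i; rewrite /update mulr_gt0//; case: ifP => // _; lra.
Qed.

Lemma update_ge p c y m i : 0 < p < 2^-1 -> 0 <= m i -> p * m i <= update p c y m i.
Proof.
move=> /andP[p0 p2] m0; rewrite /update mulrC ler_wpM2l//.
by case: ifP => // _; lra.
Qed.

Lemma update_le p c y m i : 0 < p < 2^-1 -> 0 <= m i ->
  update p c y m i <= (1 - p) * m i.
Proof.
move=> /andP[p0 p2] m0; rewrite /update [leRHS]mulrC ler_wpM2l//.
by case: ifP => // _; lra.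
Qed.

Lemma mass_others m i : mass m - m i = \sum_(j | j != i) m j.
Proof. by rewrite /mass (bigD1 i)//= addrAC subrr add0r. Qed.

(** The loss is the mutual information of position and answer. The noise part is computed exactly by
    [term]; the entropy of the answer is at most [ln 2] by tangents of [x ln x] at half the mass. *)
Lemma entropy_drift p c m : 0 <= p < 2^-1 -> (forall i, 0 <= m i) ->
  entropy m <= entropy (update p c true m) + entropy (update p c false m)
             + (ln 2 + p * ln p + (1 - p) * ln (1 - p)) * mass m.
Proof.
move=> p01 m0; have /andP[p0 p2] := p01.
have [mm0|mm0] := eqVneq (mass m) 0.
  have mi0 i : m i = 0 by exact: mass_eq0.
  rewrite /entropy /mass /update !big1 ?mul0r ?mulr0 ?subr0 ?addr0// => i _;
    by rewrite ?mi0 !mul0r.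
have {}mm0 : 0 < mass m by rewrite lt_neqAle eq_sym mm0 mass_ge0.
have term i : update p c true m i * ln (update p c true m i)
    + update p c false m i * ln (update p c false m i)
    = m i * ln (m i) + m i * (p * ln p + (1 - p) * ln (1 - p)).
  have xM (u v : R) : 0 <= u -> 0 <= v ->
      u * v * ln (u * v) = u * v * ln u + u * v * ln v.
    rewrite le_eqVlt => /predU1P[<-|u0]; first by rewrite !mul0r addr0.
    rewrite le_eqVlt => /predU1P[<-|v0]; first by rewrite !(mulr0,mul0r) addr0.
    by rewrite lnM// mulrDr.
  have q0 : 0 <= 1 - p by lra.
  by rewrite /update; case: (c i) => /=; rewrite !xM//; ring.
have -> : entropy (update p c true m) + entropy (update p c false m) =
  mass (update p c true m) * ln (mass (update p c true m))
  + mass (update p c false m) * ln (mass (update p c false m))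
  - (\sum_i m i * ln (m i) + mass m * (p * ln p + (1 - p) * ln (1 - p))).
  rewrite /entropy addrACA -opprD; congr (_ - _).
  rewrite -big_split/= /mass mulr_suml -big_split/=.
  by apply: eq_bigr => i _; exact: term.
have w0 : 0 < mass m / 2 by rewrite divr_gt0.
have M0 := @mass_ge0 _ (@update_ge0 p c true m p01 m0).
have M1 := @mass_ge0 _ (@update_ge0 p c false m p01 m0).
have H0 := @xlnx_tangent R (mass m / 2) _ w0 M0.
have H1 := @xlnx_tangent R (mass m / 2) _ w0 M1.
have := lerD H0 H1; rewrite ln_div ?posrE// /entropy.
move: (ln (mass m)) (ln 2) => L L2; rewrite -(mass_update p c m).
move: (mass (update _ _ _ _)) (mass (update _ _ _ _)) => a b.
lra.
Qed.

Lemma entropy_ge0 m : (forall i, 0 <= m i) -> 0 <= entropy m.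
Proof.
move=> m0; rewrite /entropy subr_ge0 {2}/mass mulr_suml; apply: ler_sum => i _.
have := m0 i; rewrite le_eqVlt => /predU1P[<-|mi0]; first by rewrite !mul0r.
rewrite ler_wpM2l// ler_ln ?posrE// ?(lt_le_trans mi0)//; exact: le_mass.
Qed.

Lemma entropy_fano m i : (forall i, 0 <= m i) ->
  entropy m <= mass m * ln 2 + (mass m - m i) * ln #|I|%:R.
Proof.
move=> m0.
have [mm0|mm0] := eqVneq (mass m) 0.
  have mi0 j : m j = 0 by exact: mass_eq0.
  rewrite /entropy mm0 mi0 !mul0r subrr mul0r addr0 sub0r.
  by rewrite big1 ?oppr0// => j _; rewrite mi0 mul0r.
have {}mm0 : 0 < mass m by rewrite lt_neqAle eq_sym mm0 mass_ge0.
have N0 : 0 < #|I|%:R :> R by rewrite ltr0n; apply/card_gt0P; exists i.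
(* Gibbs' inequality against this reference measure, which puts half of the mass on [i] and has
   total at most [mass m], gives Fano's bound. *)
pose nu j := if j == i then mass m / 2 else mass m / (2 * #|I|%:R).
have nu0 j : 0 < nu j by rewrite /nu; case: ifP => _; rewrite divr_gt0// mulr_gt0.
have H : \sum_j (m j * ln (nu j) + m j - nu j) <= \sum_j m j * ln (m j).
  by apply: ler_sum => j _; exact: xlnx_tangent.
have nuE : \sum_j nu j <= mass m.
  apply: (@le_trans _ _ (mass m / 2 + \sum_(j : I) (mass m / (2 * #|I|%:R)))).
    rewrite (bigD1 i)//= {1}/nu eqxx lerD2l [leRHS](bigD1 i)//=.
    apply: ler_wpDl; first by rewrite divr_ge0 ?mulr_ge0// ltW.
    by apply: ler_sum => j /negPf ji; rewrite /nu ji.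
  have -> : \sum_(j : I) (mass m / (2 * #|I|%:R)) = mass m / (2 * #|I|%:R) * #|I|%:R.
    by rewrite sumr_const -[LHS]mulr_natr.
  have -> : mass m / (2 * #|I|%:R) * #|I|%:R = mass m / 2.
    by field; rewrite gt_eqF.
  lra.
have ln_nuE : \sum_j m j * ln (nu j) =
    mass m * (ln (mass m) - ln 2) - (mass m - m i) * ln #|I|%:R.
  rewrite mass_others {1}/mass !mulr_suml (bigD1 i)//= [in RHS](bigD1 i)//=.
  rewrite {1}/nu eqxx ln_div ?posrE// -addrA; congr (_ + _).
  rewrite -sumrB; apply: eq_bigr => j /negPf ji.
  by rewrite /nu ji ln_div ?posrE ?mulr_gt0// lnM ?posrE//; ring.
move: H; rewrite sumrB big_split/= ln_nuE -/(mass m) /entropy.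
move: nuE; set A := \sum_j _; set B := \sum_j _; lra.
Qed.

(** Fano's bound at every guess [i], averaged with the weights [m i]. *)
Lemma entropy_gini m : (forall i, 0 <= m i) ->
  mass m * entropy m <= mass m ^+ 2 * ln 2 + gini m * ln #|I|%:R.
Proof.
move=> m0; rewrite {1}/mass mulr_suml.
apply: (@le_trans _ _ (\sum_i (m i * (mass m * ln 2)
                      + m i * (mass m - m i) * ln #|I|%:R))).
  apply: ler_sum => i _; rewrite -mulrA -mulrDr ler_wpM2l//; exact: entropy_fano.
by rewrite big_split/= -!mulr_suml -/(gini m) -/(mass m) expr2 mulrA.
Qed.

(** The term at [i] and the sum of all the others are each at most [mass m * (mass m - m i)]. *)
Lemma gini_le m i : (forall i, 0 <= m i) ->
  gini m <= 2 * mass m * (mass m - m i).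
Proof.
move=> m0; rewrite /gini (bigD1 i)//=.
have mi : 0 <= mass m - m i by rewrite subr_ge0; exact: le_mass.
have : \sum_(j | j != i) m j * (mass m - m j) <= (mass m - m i) * mass m.
  rewrite mass_others mulr_suml; apply: ler_sum => j _.
  by rewrite ler_wpM2l// gerBl.
have := @ler_wpM2r _ _ mi _ _ (@le_mass m i m0).
set A := \sum_(_ | _) _; lra.
Qed.

Lemma others_gt0 m i : (1 < #|I|)%N -> (forall i, 0 < m i) -> 0 < mass m - m i.
Proof.
move=> I1 m0; rewrite mass_others.
have : (0 < #|predC1 i|)%N by rewrite cardC1; case: #|I| I1 => [|[]].
case/card_gt0P => j; rewrite inE => /= ji.
by rewrite (bigD1 j)//= ltr_wpDr// sumr_ge0// => k _; exact: ltW.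
Qed.

Lemma gini_gt0 m : (1 < #|I|)%N -> (forall i, 0 < m i) -> 0 < gini m.
Proof.
move=> I1 m0; have /card_gt0P[i _] : (0 < #|I|)%N by exact: ltnW.
have g0 j : 0 < m j * (mass m - m j) by rewrite mulr_gt0// others_gt0.
by rewrite /gini (bigD1 i)//= ltr_wpDr// sumr_ge0// => j _; exact: ltW.
Qed.

Lemma others_update_ge p c y m i : 0 < p < 2^-1 -> (forall i, 0 <= m i) ->
  p * (mass m - m i) <= mass (update p c y m) - update p c y m i.
Proof.
by move=> p01 m0; rewrite !mass_others mulr_sumr; apply: ler_sum => j _; exact: update_ge.
Qed.

Lemma others_update_le p c y m i : 0 < p < 2^-1 -> (forall i, 0 <= m i) ->
  mass (update p c y m) - update p c y m i <= (1 - p) * (mass m - m i).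
Proof.
by move=> p01 m0; rewrite !mass_others mulr_sumr; apply: ler_sum => j _; exact: update_le.
Qed.

(** Each factor of each product shrinks at most by [p]. *)
Lemma gini_update_ge p c y m : 0 < p < 2^-1 -> (forall i, 0 <= m i) ->
  p ^+ 2 * gini m <= gini (update p c y m).
Proof.
move=> p01 m0; have /andP[p0 p2] := p01.
rewrite /gini mulr_sumr; apply: ler_sum => i _.
rewrite expr2 mulrACA ler_pM ?mulr_ge0 ?subr_ge0 ?le_mass ?update_ge
  ?others_update_ge//; exact: ltW.
Qed.

(** [log_sum] reduces the logarithm of the sum [gini] to a mean, with weights [g m i], of the
    logarithms of its terms; for each term [coordinate_drift] gives the divergence bound. *)
Lemma gini_drift p c m : 0 < p < 2^-1 -> (1 < #|I|)%N -> (forall i, 0 < m i) ->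
  mass m * (ln (gini m) - 2 * ln (mass m))
  <= \sum_(y : bool) mass (update p c y m)
       * (ln (gini (update p c y m)) - 2 * ln (mass (update p c y m)))
     + (1 - 2 * p) * (ln (1 - p) - ln p) * mass m.
Proof.
move=> p01 I1 m0; have /andP[p0 p2] := p01.
have /card_gt0P[i0 _] : (0 < #|I|)%N by exact: ltnW.
pose g m i := m i * (mass m - m i).
have g0 m' i : (forall i, 0 < m' i) -> 0 < g m' i.
  by move=> h; rewrite mulr_gt0// others_gt0.
have u0 y : forall i, 0 < update p c y m i by exact: update_gt0.
set D := (1 - 2 * p) * _; set u := update p c in u0 *; set w := mass m.
(* [r true] and [r false] are the updated weights of all positions but [i], so
   for each [i] the update is that of a two-point prior. *)
have coord i : \sum_(y : bool) mass (u y m) * (2 * ln (mass (u y m)) - ln (g (u y m) i))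
    <= w * (2 * ln w - ln (g m i) + D).
  have m0' j := ltW (m0 j).
  rewrite big_bool/=.
  pose r y := mass (u y m) - u y m i.
  have rE : r true + r false = mass m - m i.
    rewrite /r addrACA -opprD mass_update; congr (_ - _).
    by rewrite /u /update; case: (c i) => /=; ring.
  have r_gt0 : 0 < mass m - m i by rewrite others_gt0.
  have rb y : p * (mass m - m i) <= r y <= (1 - p) * (mass m - m i).
    by rewrite others_update_ge ?others_update_le.
  have wi : m i + (mass m - m i) = w by rewrite addrC subrK.
  have uE y : u y m i + r y = mass (u y m) by rewrite /r addrC subrK.
  case: (boolP (c i)) => ci.
    have uT : u true m i = m i * (1 - p) by rewrite /u /update ci.
    have uF : u false m i = m i * p by rewrite /u /update ci.
    have := @coordinate_drift R p _ _ _ _ p01 (m0 i) r_gt0 rE (rb true).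
    by cbv zeta; rewrite -uT -uF !uE wi.
  (* Here the answer favouring [i] is [false], so the two answers exchange roles. *)
  have uT : u true m i = m i * p by rewrite /u /update (negPf ci).
  have uF : u false m i = m i * (1 - p) by rewrite /u /update (negPf ci).
  rewrite addrC in rE.
  have := @coordinate_drift R p _ _ _ _ p01 (m0 i) r_gt0 rE (rb false).
  by cbv zeta; rewrite -uT -uF !uE wi addrC.
have G0 : 0 < gini m by exact: gini_gt0.
have ls y := @log_sum R I i0 (g m) (g (u y m))
  (fun i => g0 _ i m0) (fun i => g0 _ i (u0 y)).
have W0 y : 0 <= mass (u y m) by exact: ltW (@mass_gt0 _ i0 (u0 y)).
have {}coord := ler_sum (index_enum I)
  (fun i (_ : true) => ler_wpM2l (ltW (g0 _ i m0)) (coord i)).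
have wE : mass (u true m) + mass (u false m) = w by exact: mass_update.
have := lerD (ler_wpM2l (W0 true) (ls true)) (ler_wpM2l (W0 false) (ls false)).
move: coord; rewrite -!/(gini _) big_bool/=.
under eq_bigr do rewrite big_bool/=.
pose Sg y := \sum_i g m i * ln (g (u y m) i).
pose S0 := \sum_i g m i * ln (g m i).
have lsE y : \sum_i g m i * (ln (g (u y m) i) - ln (g m i)) = Sg y - S0.
  by rewrite /Sg /S0 -sumrB; apply: eq_bigr => i _; rewrite mulrBr.
rewrite !lsE.
have -> : \sum_i g m i *
    (mass (u true m) * (2 * ln (mass (u true m)) - ln (g (u true m) i))
     + mass (u false m) * (2 * ln (mass (u false m)) - ln (g (u false m) i)))
  = mass (u true m) * (2 * ln (mass (u true m)) * gini m - Sg true)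
  + mass (u false m) * (2 * ln (mass (u false m)) * gini m - Sg false).
  rewrite /Sg !mulr_sumr -!sumrB !mulr_sumr -big_split/=; apply: eq_bigr => i _.
  rewrite -/(g m i); ring.
have -> : \sum_i g m i * (w * (2 * ln w - ln (g m i) + D)) =
  w * ((2 * ln w + D) * gini m - S0).
  rewrite /S0 mulr_sumr -sumrB mulr_sumr; apply: eq_bigr => i _.
  rewrite -/(g m i); ring.
move=> H1 H2; rewrite -(ler_pM2l G0).
have := lerD H1 H2; rewrite -wE.
move: (ln (gini (u true m))) (ln (gini (u false m))) (ln (gini m)) (ln (mass (u true m)))
  (ln (mass (u false m))) => l1 l0 l L1 L0.
move: (ln _) => L.
move=> H; rewrite -subr_ge0 in H; rewrite -subr_ge0; move: H; congr (0 <= _); ring.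
Qed.

End Measures.

(** * The tree of histories *)

Section Leaves.
Context {R : realType} {n : nat} (S : scheme n).
Implicit Types (F G w : seq bool -> R) (ys : seq bool).

Lemma queries_aux_rcons (f : seq bool -> seq 'I_n.-1 -> 'I_n.-1) py pu ys y :
  queries_aux f py pu (rcons ys y)
  = rcons (queries_aux f py pu ys) (f (py ++ ys) (queries_aux f py pu ys)).
Proof.
elim: ys py pu => [|z ys IH] py pu /=; first by rewrite cats0.
by rewrite IH cat_rcons.
Qed.

Lemma queries_rcons ys y :
  queries S (rcons ys y) = rcons (queries S ys) (query S ys (queries S ys)).
Proof. by rewrite /queries queries_aux_rcons. Qed.

Lemma size_queries ys : size (queries S ys) = size ys.
Proof. by elim/last_ind: ys => // ys y IH; rewrite queries_rcons !size_rcons IH. Qed.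

Definition reached ys : bool :=
  all (fun i => ~~ stop S (take i ys) (take i (queries S ys))) (iota 0 (size ys)).

Definition continues ys : bool := reached ys && ~~ stop S ys (queries S ys).

Lemma reached_rcons ys y : reached (rcons ys y) = continues ys.
Proof.
rewrite /continues /reached queries_rcons size_rcons -addn1 iotaD all_cat/= andbT.
congr (_ && _); last first.
  rewrite add0n -cats1 takel_cat// take_size -cats1.
  by rewrite -{1}(size_queries ys) takel_cat// take_size.
apply: eq_in_all => i; rewrite mem_iota add0n => /andP[_ /ltnW iys].
by rewrite -!cats1 !takel_cat// size_queries.
Qed.

Lemma sum_tuple_rcons k F :
  \sum_(ys : k.+1.-tuple bool) F ys
  = \sum_(ys : k.-tuple bool) (F (rcons ys true) + F (rcons ys false)).
Proof.
pose h (q : k.-tuple bool * bool) := [tuple of rcons q.1 q.2].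
have hb : bijective h.
  apply: inj_card_bij; last by rewrite card_prod !card_tuple card_bool expnS mulnC.
  move=> [s y] [s' y'] /(congr1 val)/= /rcons_inj[ss ->].
  by congr (_, _); exact: val_inj.
rewrite (reindex h)/=; last exact: onW_bij.
rewrite -(pair_bigA _ (fun s y => F (rcons (tval s) y)))/=.
by apply: eq_bigr => s _; rewrite big_bool.
Qed.

Definition reach_sum k F := \sum_(ys : k.-tuple bool | reached ys) F ys.
Definition stop_sum k F := \sum_(ys : k.-tuple bool | stops_at S ys) F ys.
Definition cont_sum k F := \sum_(ys : k.-tuple bool | continues ys) F ys.

Lemma reach_sum0 F : reach_sum 0 F = F [::].
Proof.
rewrite /reach_sum (big_pred1 [tuple])// => t.
by rewrite [t]tuple0/= eqxx.
Qed.

Lemma reach_sum_split k F : reach_sum k F = stop_sum k F + cont_sum k F.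
Proof.
rewrite /reach_sum (bigID (fun ys : k.-tuple bool => stop S ys (queries S ys)))/=.
by congr (_ + _); apply: eq_bigl => ys; rewrite /stops_at andbC.
Qed.

Lemma reach_sumS k F :
  reach_sum k.+1 F = cont_sum k (fun ys => F (rcons ys true) + F (rcons ys false)).
Proof.
rewrite /reach_sum big_mkcond/=.
rewrite (sum_tuple_rcons k (fun ys => if reached ys then F ys else 0)).
rewrite /cont_sum [RHS]big_mkcond/=; apply: eq_bigr => ys _.
by rewrite !reached_rcons; case: ifP => // _; rewrite addr0.
Qed.

(* The leaves of the tree truncated at depth [N]: the histories stopped before
   time [N], and those of length [N] that were not. *)
Definition leaf_sum N F := \sum_(k < N) stop_sum k F + reach_sum N F.

Lemma leaf_sum_le N F G : (forall ys, F ys <= G ys) -> leaf_sum N F <= leaf_sum N G.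
Proof.
by move=> FG; apply: lerD; [apply: ler_sum => k _|]; apply: ler_sum.
Qed.

Lemma leaf_sumD N F G : leaf_sum N (fun ys => F ys + G ys) = leaf_sum N F + leaf_sum N G.
Proof.
rewrite /leaf_sum /reach_sum [in LHS]big_split/= addrACA -[in RHS]big_split/=.
by congr (_ + _); apply: eq_bigr => k _; rewrite /stop_sum big_split.
Qed.

Lemma leaf_sumZ N a F : leaf_sum N (fun ys => a * F ys) = a * leaf_sum N F.
Proof.
rewrite /leaf_sum /reach_sum mulrDr !mulr_sumr; congr (_ + _).
by apply: eq_bigr => k _; rewrite /stop_sum mulr_sumr.
Qed.

(** Deepening the truncation replaces each continuing leaf by its two children. *)
Lemma leaf_sumS N F :
  leaf_sum N.+1 F = leaf_sum N F - cont_sum N F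
    + cont_sum N (fun ys => F (rcons ys true) + F (rcons ys false)).
Proof.
rewrite /leaf_sum big_ord_recr/= reach_sumS (reach_sum_split N); ring.
Qed.

Section Weight.
Variable w : seq bool -> R.
Hypothesis w_split : forall ys, w (rcons ys true) + w (rcons ys false) = w ys.

Lemma reach_sumS_weight k : reach_sum k.+1 w = cont_sum k w.
Proof. by rewrite reach_sumS /cont_sum; apply: eq_bigr => ys _; rewrite w_split. Qed.

Lemma leaf_sum_weight N : leaf_sum N w = w [::].
Proof.
elim: N => [|N IH]; first by rewrite /leaf_sum big_ord0 add0r reach_sum0.
by rewrite leaf_sumS -reach_sumS reach_sumS_weight subrK.
Qed.

(** Optional stopping in finite form: each expanded node costs at most its weight, and the nodes
    expanded at level [k] weigh [reach_sum k.+1 w]. *)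
Lemma leaf_sum_drift N F :
  (forall ys, F ys <= F (rcons ys true) + F (rcons ys false) + w ys) ->
  F [::] <= leaf_sum N F + \sum_(k < N) reach_sum k.+1 w.
Proof.
move=> dF; elim: N => [|N IH].
  by rewrite /leaf_sum !big_ord0 add0r addr0 reach_sum0.
apply: (le_trans IH); rewrite leaf_sumS big_ord_recr/= reach_sumS_weight.
have : cont_sum N F <= cont_sum N (fun ys => F (rcons ys true) + F (rcons ys false))
    + cont_sum N w.
  by rewrite /cont_sum -big_split/=; exact: ler_sum.
set A := leaf_sum N F; set B := \sum_(_ < _) _; lra.
Qed.

(* Both sides are [E[min(M, N)]]. *)
Lemma sum_reach_sum N :
  \sum_(k < N) reach_sum k.+1 w = \sum_(k < N) k%:R * stop_sum k w + N%:R * reach_sum N w.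
Proof.
elim: N => [|N IH]; first by rewrite !big_ord0 mul0r addr0.
rewrite !big_ord_recr/= IH (reach_sum_split N) -reach_sumS_weight -natr1; ring.
Qed.

(** Histories that stop between [N] and [N'] are charged their true length instead of [N]. Later
    [N'] is taken so large that the last term is at most 1. *)
Lemma truncated_time_le N N' : (forall ys, 0 <= w ys) -> (N <= N')%N ->
  \sum_(k < N) k%:R * stop_sum k w + N%:R * reach_sum N w
  <= \sum_(k < N') k%:R * stop_sum k w + N%:R * reach_sum N' w.
Proof.
move=> w0; elim: N' => [|N' IH]; first by rewrite leqn0 => /eqP ->.
rewrite leq_eqVlt => /predU1P[-> //|]; rewrite ltnS => NN'.
apply: (le_trans (IH NN')).
rewrite big_ord_recr/= (reach_sum_split N') -reach_sumS_weight.
have s0 : 0 <= stop_sum N' w by apply: sumr_ge0.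
have : N%:R * stop_sum N' w <= N'%:R * stop_sum N' w by rewrite ler_wpM2r// ler_nat.
set A := \sum_(_ < _) _; lra.
Qed.

End Weight.

End Leaves.

(** * The joint law of position and responses, and its limits *)

Section Scheme.
Context {R : realType} {n : nat} (p : R) (S : scheme n).
Hypothesis p01 : 0 <= p < 2^-1.

(** The factor [1 / n] is the uniform prior, so [mass (joint ys)] is the probability of the
    responses [ys]. *)
Definition joint (ys : seq bool) (l : 'I_n) : R := n%:R^-1 * path_prob p S l ys.

Definition answer (ys : seq bool) (l : 'I_n) : bool :=
  (val (query S ys (queries S ys)) < val l)%N.

(** As [est] is total, this also makes sense at histories that have not stopped, such as the leaves
    of a truncated tree. *)
Definition error (ys : seq bool) : R :=
  mass (joint ys) - joint ys (est S ys (queries S ys)).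

Let l0 : 'I_n := est S [::] [::].

Lemma scheme_gt0 : (0 < n)%N.
Proof. by case: l0 => i /=; exact: leq_trans. Qed.

(** [query] is total, so the type of queries is inhabited. *)
Lemma scheme_gt1 : (1 < n)%N.
Proof.
by rewrite -subn_gt0 subn1 (leq_ltn_trans _ (ltn_ord (query S [::] [::]))).
Qed.

Lemma joint_rcons ys y : joint (rcons ys y) = update p (answer ys) y (joint ys).
Proof.
apply/funext => l; rewrite /joint /path_prob /update queries_rcons.
by rewrite zip_rcons ?size_queries// big_rcons/= mulrA.
Qed.

Lemma joint_nil l : joint [::] l = n%:R^-1.
Proof. by rewrite /joint /path_prob big_nil mulr1. Qed.

Lemma joint_ge0 ys l : 0 <= joint ys l.
Proof.
elim/last_ind: ys l => [|ys y IH] l; first by rewrite joint_nil invr_ge0.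
by rewrite joint_rcons; exact: update_ge0.
Qed.

Lemma joint_gt0 ys l : 0 < p -> 0 < joint ys l.
Proof.
move=> p0; elim/last_ind: ys l => [|ys y IH] l.
  by rewrite joint_nil invr_gt0 ltr0n scheme_gt0.
rewrite joint_rcons; apply: update_gt0 => //; rewrite p0; by case/andP: p01.
Qed.

Lemma mass_joint_nil : mass (joint [::]) = 1.
Proof.
rewrite /mass; under eq_bigr do rewrite joint_nil.
rewrite sumr_const card_ord -[LHS]mulr_natr mulVf// pnatr_eq0 -lt0n; exact: scheme_gt0.
Qed.

Lemma mass_joint_split ys :
  mass (joint (rcons ys true)) + mass (joint (rcons ys false)) = mass (joint ys).
Proof. by rewrite !joint_rcons mass_update. Qed.

Lemma mass_joint_ge0 ys : 0 <= mass (joint ys).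
Proof. exact: mass_ge0 (joint_ge0 ys). Qed.

Lemma error_ge0 ys : 0 <= error ys.
Proof. rewrite subr_ge0; apply: le_mass; exact: joint_ge0. Qed.

Lemma error_le ys : error ys <= mass (joint ys).
Proof. by rewrite gerBl; exact: joint_ge0. Qed.

Lemma probM_stop_sum k : probM p S k = stop_sum S k (fun ys => mass (joint ys)).
Proof.
rewrite /probM /stop_sum /mass exchange_big/= mulr_sumr.
by apply: eq_bigr => ys _; rewrite mulr_sumr.
Qed.

Lemma probErr_stop_sum k : probErr p S k = stop_sum S k error.
Proof.
rewrite /probErr /stop_sum /error mulr_sumr.
under eq_bigr do rewrite big_mkcondr/= mulr_sumr.
rewrite exchange_big/=; apply: eq_bigr => ys _.
rewrite mass_others [RHS]big_mkcond/=; apply: eq_bigr => l _.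
by rewrite eq_sym; case: ifP => // _; rewrite mulr0.
Qed.

Let wt ys := mass (joint ys).
Notation r_ N := (reach_sum S N wt).

Lemma reach_sum_mass_ge0 N : 0 <= r_ N.
Proof. by apply: sumr_ge0 => ys _; exact: mass_joint_ge0. Qed.

Lemma sum_probM N : \sum_(k < N) probM p S k = 1 - r_ N.
Proof.
have := leaf_sum_weight S wt mass_joint_split N.
rewrite {2}/wt mass_joint_nil /leaf_sum => <-; rewrite addrK.
by apply: eq_bigr => k _; exact: probM_stop_sum.
Qed.

Lemma sum_probErr_le N : \sum_(k < N) probErr p S k <= \sum_(k < N) probM p S k.
Proof.
apply: ler_sum => k _; rewrite probErr_stop_sum probM_stop_sum.
by apply: ler_sum => ys _; exact: error_le.
Qed.

Lemma cvg_partial_sums (u : nat -> R) : (forall k, 0 <= u k) ->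
  (forall N, \sum_(k < N) u k <= 1) -> cvgn (fun N => \sum_(k < N) u k).
Proof.
move=> u0 u1; apply: nondecreasing_is_cvgn.
  apply/nondecreasing_seqP => N; by rewrite big_ord_recr/= lerDl.
by exists 1 => _ [N _ <-].
Qed.

Lemma sum_probErr_Perr N : \sum_(k < N) probErr p S k <= Perr p S.
Proof.
have e0 k : 0 <= probErr p S k.
  by rewrite probErr_stop_sum; apply: sumr_ge0 => ys _; exact: error_ge0.
apply: (@nondecreasing_cvgn_le R (fun N => \sum_(k < N) probErr p S k)).
  by apply/nondecreasing_seqP => k; rewrite big_ord_recr/= lerDl.
apply: cvg_partial_sums => // M; apply: (le_trans (sum_probErr_le M)).
by rewrite sum_probM gerBl; exact: reach_sum_mass_ge0.
Qed.

(** The partial sums of [probM] equal [1 - r_ N]. Their convergence is proved first, since [limn]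
    alone does not provide it. *)
Lemma reach_sum_mass_small e N : probFinite p S = 1 -> 0 < e ->
  exists2 N', (N <= N')%N & r_ N' <= e.
Proof.
move=> pf e0.
have cv : cvgn (fun N => \sum_(k < N) probM p S k).
  apply: cvg_partial_sums => [k|M].
    by rewrite probM_stop_sum; apply: sumr_ge0 => ys _; exact: mass_joint_ge0.
  by rewrite sum_probM gerBl; exact: reach_sum_mass_ge0.
move: cv; rewrite /probFinite in pf; move=> /cvg_ex[l cvl].
have l1 : l = 1 by rewrite -pf; apply/esym/cvg_lim.
move/cvgrPdist_le: cvl => /(_ e e0)[M _ HM].
exists (maxn N M); first exact: leq_maxl.
have := HM (maxn N M) (leq_maxr _ _).
by rewrite /= l1 sum_probM opprB addrCA subrr addr0 ger0_norm// reach_sum_mass_ge0.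
Qed.

Lemma truncated_time_expM N : probFinite p S = 1 ->
  ((\sum_(k < N) reach_sum S k.+1 wt)%:E
   <= expM p S + 1%:E)%E.
Proof.
move=> pf; rewrite (sum_reach_sum S wt mass_joint_split).
(* With this tail, [N%:R * r_ N'] is at most 1, the extra term of the conclusion. *)
have [N' NN' rN'] := @reach_sum_mass_small (N.+1%:R^-1) N pf
  ltac:(by rewrite invr_gt0 ltr0n).
have Nr : N%:R * r_ N' <= 1.
  apply: (@le_trans _ _ (N.+1%:R * N.+1%:R^-1)).
    by rewrite ler_pM// ?reach_sum_mass_ge0// ler_nat.
  by rewrite divff// pnatr_eq0.
have H := @truncated_time_le R n S wt mass_joint_split N N' mass_joint_ge0 NN'.
apply: (@le_trans _ _ (\sum_(k < N') k%:R * probM p S k + 1)%:E).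
  rewrite lee_fin (le_trans H)// lerD//; apply: ler_sum => k _.
  by rewrite probM_stop_sum.
rewrite EFinD leeD2r// -sumEFin.
rewrite -(big_mkord xpredT (fun k => (k%:R * probM p S k)%:E)).
apply: nneseries_lim_ge => k _ _; rewrite lee_fin mulr_ge0//.
by rewrite probM_stop_sum; apply: sumr_ge0 => ys _; exact: mass_joint_ge0.
Qed.

(** Leaves that have not stopped are counted entirely as errors. *)
Lemma leaf_sum_error_le N : leaf_sum S N error <= Perr p S + r_ N.
Proof.
rewrite /leaf_sum lerD//.
  apply: le_trans (sum_probErr_Perr N); apply: ler_sum => k _.
  by rewrite probErr_stop_sum.
by apply: ler_sum => ys _; exact: error_le.
Qed.

Lemma Perr_le1 : Perr p S <= 1.
Proof.
apply: limr_le.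
  apply: cvg_partial_sums => [k|M].
    by rewrite probErr_stop_sum; apply: sumr_ge0 => ys _; exact: error_ge0.
  apply: (le_trans (sum_probErr_le M)).
  by rewrite sum_probM gerBl; exact: reach_sum_mass_ge0.
near=> M; apply: (le_trans (sum_probErr_le M)).
by rewrite sum_probM gerBl; exact: reach_sum_mass_ge0.
Unshelve. all: by end_near.
Qed.

End Scheme.

(** * The potential *)

Section Capacity.
Context {R : realType} (p : R).

(** Capacity and divergence are in nats; ratios to [ln] agree with the base-2 ratios of the
    theorem. *)
Definition capacity : R := ln 2 + p * ln p + (1 - p) * ln (1 - p).

Definition divergence : R := (1 - 2 * p) * (ln (1 - p) - ln p).

Lemma ln2_gt0 : 0 < ln 2 :> R. Proof. by apply: ln_gt0; lra. Qed.

Lemma capacity_gt0 : 0 <= p < 2^-1 -> 0 < capacity.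
Proof.
rewrite /capacity => /andP[]; rewrite le_eqVlt => /predU1P[<- _|p0 p2].
  by rewrite mul0r subr0 ln1 mulr0 !addr0 ln2_gt0.
have q0 : 0 < 1 - p by lra.
have h0 : 0 < 2^-1 :> R by lra.
have H := @xlnx_tangent R _ _ h0 (ltW q0).
have p2p : 0 < (2 * p)^-1 by rewrite invr_gt0 mulr_gt0.
have x0 : (2 * p)^-1 - 1 != 0.
  by rewrite subr_eq0; apply/eqP => /(congr1 (fun x => x * (2 * p)));
    rewrite mulVf ?gt_eqF ?mulr_gt0//; lra.
(* Strictness arises here, as [1 / (2 * p)] is not 1; the bound [H] for [1 - p] is weak. *)
have H' : ln (2 * p)^-1 < (2 * p)^-1 - 1.
  rewrite -ltr_expR lnK ?posrE//; have := expR_gt1Dx x0; lra.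
move: H'; rewrite lnV ?posrE ?mulr_gt0// lnM ?posrE// -(ltr_pM2l p0).
have -> : p * ((2 * p)^-1 - 1) = 2^-1 - p by field; rewrite gt_eqF.
move: H; rewrite lnV ?posrE//.
set a := ln 2; set b := ln p; set c := ln (1 - p); lra.
Qed.

Lemma divergence_gt0 : 0 < p < 2^-1 -> 0 < divergence.
Proof.
move=> /andP[p0 p2]; rewrite mulr_gt0//; first lra.
by rewrite subr_gt0 ltr_ln ?posrE//; lra.
Qed.

Lemma log2_capacity (x : R) : log2 x / (1 - Hb p) = ln x / capacity.
Proof.
have l2 := ln2_gt0.
have -> : 1 - Hb p = capacity / ln 2.
  by rewrite /Hb /log2 /capacity; field; rewrite gt_eqF.
by rewrite /log2 invfM invrK mulrA mulrAC mulfVK ?gt_eqF// mulrC.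
Qed.

Lemma log2_invD (x : R) : 0 < p < 2^-1 -> log2 x * invD p = ln x / divergence.
Proof.
move=> /andP[p0 p2]; have l2 := ln2_gt0.
have q0 : 0 < 1 - p by lra.
have -> : invD p = ln 2 / divergence.
  rewrite /invD gt_eqF// -[RHS]invrK invfM invrK mulrC; congr (_^-1).
  rewrite /Dpq /log2 !ln_div ?posrE// /divergence; ring.
by rewrite /log2 mulrA mulfVK ?gt_eqF.
Qed.

End Capacity.

Lemma entropy_capacity_drift {R : realType} {I : finType} (p : R) (c : I -> bool)
    (m : I -> R) : 0 <= p < 2^-1 -> (forall i, 0 <= m i) ->
  entropy m / capacity p <= entropy (update p c true m) / capacity p
                  + entropy (update p c false m) / capacity p + mass m.
Proof.
move=> p01 m0; have C0 := capacity_gt0 p p01.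
rewrite -(ler_pM2r C0) !mulrDl !mulfVK ?gt_eqF// [mass m * capacity p]mulrC.
exact: entropy_drift.
Qed.

Section Potential.
Context {R : realType} {I : finType} (p : R).
Hypotheses (p01 : 0 < p < 2^-1) (I1 : (1 < #|I|)%N).
Implicit Types (m : I -> R) (c : I -> bool).

Let L : R := ln #|I|%:R / ln 2.
Let Cn := capacity p.
Let Dn := divergence p.

Let p01' : 0 <= p < 2^-1.
Proof. by case/andP: p01 => /ltW -> ->. Qed.

Let Cn0 : 0 < Cn. Proof. exact: capacity_gt0. Qed.
Let Dn0 : 0 < Dn. Proof. exact: divergence_gt0. Qed.

Let L1 : 1 <= L.
Proof. by rewrite ler_pdivlMr ?ln2_gt0// mul1r ler_ln ?posrE ?ltr0n ?ler_nat// ltnW. Qed.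

Let L0 : 0 < L. Proof. exact: lt_le_trans L1. Qed.

(* The offset makes the two regimes of the potential overlap: one observation
   shrinks [gini m / mass m ^+ 2] by a factor at most [p ^+ 2]. *)
Definition offset : R := 2 * ln 2 / capacity p - ln (p ^+ 2) / divergence p.

Definition log_potential m : R :=
  mass m * ((ln (gini m) - 2 * ln (mass m) + ln (ln #|I|%:R / ln 2)) / divergence p
            + offset).

(** Thanks to the maximum, [log_potential] is a lower bound in both regimes, so its drift applies
    wherever the children fall. *)
Definition potential m : R :=
  if gini m * (ln #|I|%:R / ln 2) < mass m ^+ 2 then log_potential m
  else Num.max (entropy m / capacity p) (log_potential m).

Let i0 : I := enum_val (Ordinal I1).

Lemma ln_gini m : (forall i, 0 < m i) ->
  ln (gini m) - 2 * ln (mass m) + ln L = ln (gini m * L / mass m ^+ 2).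
Proof.
move=> m0; have G0 := gini_gt0 m I1 m0; have W0 := mass_gt0 m i0 m0.
have GL0 := mulr_gt0 G0 L0; have W2 := exprn_gt0 2 W0.
rewrite [in RHS]ln_div ?posrE// lnM ?posrE// lnXn//.
by rewrite -[ln (mass m) *+ 2]mulr_natl addrAC.
Qed.

Lemma le_log_potential m : log_potential m <= potential m.
Proof. by rewrite /potential; case: ifP => // _; rewrite le_max lexx orbT. Qed.

(** In the small regime [entropy_gini] bounds the normalized entropy by [2 * ln 2], and [offset] is
    chosen so that the logarithmic branch is still at least [2 * ln 2 / Cn]. *)
Lemma le_entropy_potential m : (forall i, 0 < m i) ->
  p ^+ 2 * mass m ^+ 2 <= gini m * L -> entropy m / Cn <= potential m.
Proof.
move=> m0 pG; rewrite /potential -/L -/Cn; case: ifP => [small|_]; last first.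
  by rewrite le_max lexx.
have /andP[p0 p2] := p01; have m0' i := ltW (m0 i).
have G0 := gini_gt0 m I1 m0; have W0 := mass_gt0 m i0 m0.
have l2 := @ln2_gt0 R.
have H : entropy m <= mass m * (2 * ln 2).
  rewrite -(ler_pM2l W0); apply: (le_trans (entropy_gini m m0')).
  have -> : ln #|I|%:R = L * ln 2 by rewrite /L mulfVK ?gt_eqF.
  have := ler_wpM2r (ltW l2) (ltW small); rewrite expr2; lra.
apply: (@le_trans _ _ (mass m * (2 * ln 2) / Cn)); first by rewrite ler_pM2r ?invr_gt0.
rewrite /log_potential -/L ln_gini// /offset -/Cn -/Dn -mulrA ler_wpM2l ?(ltW W0)//.
rewrite addrCA lerDl -mulrBl divr_ge0 ?(ltW Dn0)// subr_ge0 ler_ln ?posrE.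
- by rewrite ler_pdivlMr ?exprn_gt0.
- by rewrite exprn_gt0.
- exact: divr_gt0 (mulr_gt0 G0 L0) (exprn_gt0 2 W0).
Qed.

Lemma log_potential_drift c m : (forall i, 0 < m i) ->
  log_potential m <= log_potential (update p c true m)
                   + log_potential (update p c false m) + mass m.
Proof.
move=> m0; have := @gini_drift R I p c m p01 I1 m0.
rewrite big_bool/= -/Dn /log_potential -/L -/Dn => H.
have d0 : 0 <= Dn^-1 by rewrite invr_ge0 ltW.
have := ler_wpM2r d0 H; rewrite [X in _ <= X]mulrDl.
have -> : (1 - 2 * p) * (ln (1 - p) - ln p) * mass m / Dn = mass m.
  by rewrite mulrAC divff ?gt_eqF// mul1r.
have wE := mass_update p c m; clear H.
move: (ln (gini _)) (ln (gini _)) (ln (gini _)) => g g1 g0.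
move: (ln (mass m)) (ln (mass _)) (ln (mass _)) => l l1 l0.
move: (ln L) offset Dn^-1 => lL K d; rewrite -wE.
move: (mass _) (mass _) => w1 w0; lra.
Qed.

(** In the large regime both children satisfy the hypothesis of [le_entropy_potential], since [gini]
    keeps a factor [p ^+ 2] and the mass does not grow. *)
Lemma potential_drift c m : (forall i, 0 < m i) ->
  potential m <= potential (update p c true m) + potential (update p c false m) + mass m.
Proof.
move=> m0; have m0' i := ltW (m0 i).
have b_drift : log_potential m <=
    potential (update p c true m) + potential (update p c false m) + mass m.
  apply: (le_trans (log_potential_drift c _ m0)).
  by rewrite lerD2r lerD// le_log_potential.
rewrite {1}/potential -/L -/Cn; case: ifPn => // large.
rewrite ge_max b_drift andbT; apply: (le_trans (entropy_capacity_drift p c _ p01' m0')).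
rewrite -leNgt in large; have /andP[p0 p2] := p01.
have uV y : entropy (update p c y m) / Cn <= potential (update p c y m).
  apply: le_entropy_potential; first exact: update_gt0.
  apply: (@le_trans _ _ (p ^+ 2 * gini m * L)).
    rewrite -mulrA ler_wpM2l ?exprn_ge0 ?(ltW p0)//; apply: le_trans large.
    rewrite lerXn2r ?nnegrE ?mass_ge0//; last first.
      apply: ler_sum => i _; rewrite /update ler_piMr//; case: ifP => _; lra.
    by apply: update_ge0.
  by rewrite ler_wpM2r ?(ltW L0)// gini_update_ge.
by rewrite lerD2r lerD.
Qed.

(** Where the maximum is taken both branches are nonnegative, so their sum bounds it. *)
Lemma potential_le m : (forall i, 0 < m i) ->
  potential m <= log_potential m + entropy m / Cn.
Proof.
move=> m0; have m0' i := ltW (m0 i); have /andP[p0 p2] := p01.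
have W0 := mass_gt0 m i0 m0.
have a0 : 0 <= entropy m / Cn by rewrite divr_ge0 ?(ltW Cn0)// entropy_ge0.
rewrite /potential -/L -/Cn; case: ifPn => [_|]; first by rewrite lerDl.
rewrite -leNgt => large; rewrite ge_max lerDl a0 andbT lerDr.
rewrite /log_potential -/L ln_gini// mulr_ge0 ?(ltW W0)//.
have ln0 : 0 <= ln (gini m * L / mass m ^+ 2).
  by rewrite ln_ge0// ler_pdivlMr ?exprn_gt0// mul1r.
rewrite addr_ge0 ?divr_ge0 ?(ltW Dn0)// /offset subr_ge0.
apply: (@le_trans _ _ 0).
  rewrite mulr_le0_ge0 ?invr_ge0 ?(ltW Dn0)// ln_le0// expr2; nra.
by rewrite divr_ge0 ?(ltW Cn0)// mulr_ge0// ltW// ln2_gt0.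
Qed.

(** The tangent of [ln] at [z] and [gini_le] give a bound linear in mass and error, which can be
    summed over leaves. *)
Lemma log_potential_le m i (z : R) : (forall i, 0 < m i) -> 0 < z ->
  log_potential m <= (offset + (ln z - 1) / Dn) * mass m
                     + 2 * L / z / Dn * (mass m - m i).
Proof.
move=> m0 z0; have m0' j := ltW (m0 j).
have G0 := gini_gt0 m I1 m0; have W0 := mass_gt0 m i0 m0.
rewrite /log_potential -/L ln_gini// -/Dn.
have x0 : 0 < gini m * L / mass m ^+ 2.
  exact: divr_gt0 (mulr_gt0 G0 L0) (exprn_gt0 2 W0).
have := @ln_tangent R _ _ z0 x0; set lx := ln _ => H1.
have H2 : gini m * L / mass m ^+ 2 / z * mass m <= 2 * L / z * (mass m - m i).
  have -> : gini m * L / mass m ^+ 2 / z * mass m = gini m * (L / (z * mass m)).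
    by field; rewrite !gt_eqF.
  have -> : 2 * L / z * (mass m - m i) =
      2 * mass m * (mass m - m i) * (L / (z * mass m)) by field; rewrite !gt_eqF.
  by apply: ler_wpM2r; [exact: divr_ge0 (ltW L0) (ltW (mulr_gt0 z0 W0))|exact: gini_le].
have d0 : 0 <= Dn^-1 by rewrite invr_ge0 ltW.
have := ler_wpM2l d0 (lerD (ler_wpM2r (ltW W0) H1) H2).
move: (gini m * L / mass m ^+ 2 / z) (2 * L / z) => A B.
move: offset (ln z) Dn^-1 (mass m) (m i) => K lz d w e; lra.
Qed.

End Potential.

(** * From the potential to the expected number of queries *)

Lemma leaf_bound {R : realType} {n : nat} (p : R) (S : scheme n)
    (F : seq bool -> R) (a b e : R) :
  0 <= p < 2^-1 -> probFinite p S = 1 -> 0 < e -> 0 <= b ->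
  (forall ys, F ys <= F (rcons ys true) + F (rcons ys false) + mass (joint p S ys)) ->
  (forall ys, F ys <= a * mass (joint p S ys) + b * error p S ys) ->
  ((F [::] - a - b * (Perr p S + e) - 1)%:E <= expM p S)%E.
Proof.
move=> p01 pf e0 b0 dF uF.
have [N _ rN] := @reach_sum_mass_small R n p S p01 e 0 pf e0.
have T := @truncated_time_expM R n p S p01 N pf.
have D := @leaf_sum_drift R n S _ (@mass_joint_split R n p S) N F dF.
have U := @leaf_sum_le R n S N _ _ uF.
(* Over all leaves [a] meets total mass 1, and [b] meets total error at most [Perr p S + e]. *)
rewrite leaf_sumD !leaf_sumZ (@leaf_sum_weight R n S _ (@mass_joint_split R n p S)) in U.
rewrite mass_joint_nil mulr1 in U.
have E := ler_wpM2l b0 (le_trans (@leaf_sum_error_le R n p S p01 N) (lerD (lexx _) rN)).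
rewrite EFinB leeBlDr//; apply: le_trans T; rewrite lee_fin.
move: D U E; set A := \sum_(_ < _) _; lra.
Qed.

Lemma entropy_joint_nil {R : realType} {n : nat} (p : R) (S : scheme n) :
  entropy (joint p S [::]) = ln n%:R.
Proof.
rewrite /entropy mass_joint_nil ln1 mulr0 sub0r.
under eq_bigr do rewrite joint_nil.
have n0 : 0 < n%:R :> R by rewrite ltr0n (scheme_gt0 S).
rewrite sumr_const card_ord -[_ *+ n]mulr_natr lnV ?posrE//.
by field; rewrite gt_eqF.
Qed.

Lemma gini_joint_nil {R : realType} {n : nat} (p : R) (S : scheme n) :
  gini (joint p S [::]) = 1 - n%:R^-1.
Proof.
rewrite /gini mass_joint_nil; under eq_bigr do rewrite joint_nil.
have n0 : 0 < n%:R :> R by rewrite ltr0n (scheme_gt0 S).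
rewrite sumr_const card_ord -[_ *+ n]mulr_natr.
by field; rewrite gt_eqF.
Qed.

Theorem theorem8 (R : realType) (p : R) :
  0 <= p -> p < 2^-1 ->
  exists C : R, forall (n : nat) (S : scheme n),
    (0 < n)%N ->
    probFinite p S = 1 ->
    0 < Perr p S ->
    ((log2 n%:R / (1 - Hb p)
      + log2 (Perr p S)^-1 * invD p
      - log2 (log2 (n%:R / Perr p S)) * invD p
      - Perr p S * log2 n%:R / (1 - Hb p)
      - C)%:E < expM p S)%E.
Proof.
move=> p0 p2; have p01 : 0 <= p < 2^-1 by rewrite p0.
have C0 := capacity_gt0 p p01; have l2 := @ln2_gt0 R.
set Cn := capacity p in C0; have Cn0 : 0 <= Cn^-1 by rewrite invr_ge0 ltW.
have ln_n n : scheme n -> 0 < ln n%:R :> R.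
  by move=> S; rewrite ln_gt0 // ltr1n (scheme_gt1 S).
have entropy_le n (S : scheme n) ys : entropy (joint p S ys) / Cn
    <= ln 2 / Cn * mass (joint p S ys) + ln n%:R / Cn * error p S ys.
  have := @entropy_fano R _ _ (est S ys (queries S ys)) (@joint_ge0 R n p S p01 ys).
  rewrite card_ord => /(ler_wpM2r Cn0) /le_trans; apply.
  rewrite /error; lra.
(* For [p = 0] weights may vanish and [invD p] is 0: the entropy potential alone suffices. *)
move: p0; rewrite le_eqVlt => /predU1P[pE|p_gt0].
  exists (ln 2 / Cn + 1 / Cn + 2) => n S _ pf _.
  have L0 := ln_n n S; have e0 : 0 < (ln n%:R)^-1 :> R by rewrite invr_gt0.
  have b0 : 0 <= ln n%:R / Cn by rewrite divr_ge0 ?ltW.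
  have dF ys : entropy (joint p S ys) / Cn <= entropy (joint p S (rcons ys true)) / Cn
      + entropy (joint p S (rcons ys false)) / Cn + mass (joint p S ys).
    by rewrite !joint_rcons; apply: entropy_capacity_drift => //; exact: joint_ge0.
  apply: lt_le_trans (leaf_bound p S _ _ _ _ p01 pf e0 b0 dF (entropy_le n S)).
  rewrite lte_fin entropy_joint_nil log2_capacity -[Perr p S * _ / _]mulrA log2_capacity.
  rewrite /invD -pE eqxx !mulr0 !pE -/Cn mulrDr.
  have -> : ln n%:R / Cn / ln n%:R = 1 / Cn by field; rewrite !gt_eqF.
  lra.
have p01s : 0 < p < 2^-1 by rewrite p_gt0.
have D0 := divergence_gt0 p p01s; set Dn := divergence p in D0.
(* Of the final 2, one unit is lost in [leaf_bound] and the other makes the inequality strict. *)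
exists (offset p + ln 4 / Dn + ln 2 / Cn + 1 / Cn + 2) => n S _ pf P0.
have n1 := scheme_gt1 S; have ln_n0 := ln_n n S.
have N0 : 0 < n%:R :> R by rewrite ltr0n (scheme_gt0 S).
set P := Perr p S in P0 *; have [L LE] : exists L : R, L = ln n%:R / ln 2 by eexists.
have I1 : (1 < #|'I_n|)%N by rewrite card_ord.
have L1 : 1 <= L by rewrite LE ler_pdivlMr// mul1r ler_ln ?posrE ?ler_nat.
have L0 : 0 < L by exact: lt_le_trans L1.
(* The tangent point bounds the mean of [gini * L] per unit mass: [gini] is at most twice the error,
   whose total is at most [P + e <= 2 * P]. The slope term is then at most [1 / Dn] and cancels the
   [- 1 / Dn] of the tangent. *)
pose z := 4 * P * L; have z0 : 0 < z by rewrite /z !mulr_gt0.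
(* The two bounds on [e] serve the logarithmic and the entropy part of [b * (P + e)]. *)
pose e := Num.min P (ln n%:R)^-1.
have e0 : 0 < e by rewrite lt_min P0 invr_gt0.
have jg ys := @joint_gt0 R n p S p01 ys ^~ p_gt0.
pose b := 2 * L / z / Dn + ln n%:R / Cn.
have b0 : 0 <= b.
  by rewrite addr_ge0// ?divr_ge0 ?(ltW C0) ?(ltW ln_n0) ?(ltW D0) ?(ltW z0)
    ?mulr_ge0 ?(ltW L0).
pose F ys := potential p (joint p S ys).
have dF ys : F ys <= F (rcons ys true) + F (rcons ys false) + mass (joint p S ys).
  by rewrite /F !joint_rcons; exact: potential_drift.
have uF ys : F ys <= (offset p + (ln z - 1) / Dn + ln 2 / Cn) * mass (joint p S ys)
    + b * error p S ys.
  have := potential_le p p01s I1 _ (jg ys).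
  have := @log_potential_le R _ p p01s I1 _ (est S ys (queries S ys)) z (jg ys) z0.
  have := entropy_le n S ys.
  rewrite card_ord -LE -/Dn -/Cn -/(error p S ys) /F /b; lra.
have root : ln n%:R / Cn <= F [::].
  rewrite -(entropy_joint_nil p S); apply: le_entropy_potential => //.
  (* What remains is [p ^+ 2 <= (1 - 1 / n) * L], true as [n >= 2] and [L >= 1]. *)
  rewrite mass_joint_nil gini_joint_nil card_ord -LE expr1n mulr1.
  have n2 : n%:R^-1 <= 2^-1 :> R by rewrite lef_pV2 ?posrE// ler_nat.
  nra.
apply: lt_le_trans (leaf_bound p S F _ b e p01 pf e0 b0 dF uF); rewrite lte_fin -/P.
have be : b * (P + e) <= 1 / Dn + (P * (ln n%:R / Cn) + 1 / Cn).
  rewrite /b mulrDl; apply: lerD.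
    have -> : 2 * L / z / Dn * (P + e) = (P + e) / (2 * P) / Dn.
      by rewrite /z; field; rewrite !gt_eqF.
    rewrite ler_pM2r ?invr_gt0// ler_pdivrMr ?mulr_gt0//.
    have : e <= P by rewrite ge_min lexx.
    lra.
  rewrite mulrDr mulrC lerD2l mulrAC ler_pM2r ?invr_gt0//.
  have : e <= (ln n%:R)^-1 by rewrite ge_min lexx orbT.
  by move/(ler_wpM2l (ltW ln_n0)); rewrite divff ?gt_eqF.
have lz : ln z = ln 4 + ln P + ln L by rewrite /z !lnM ?posrE ?mulr_gt0.
have P1 : P <= 1 by exact: Perr_le1.
have LL : ln L / Dn <= log2 (log2 (n%:R / P)) * invD p.
  rewrite log2_invD// ler_pM2r ?invr_gt0//.
  have Ln : L <= log2 (n%:R / P).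
    rewrite LE /log2 ler_pM2r ?invr_gt0// ler_ln ?posrE ?divr_gt0//.
    by rewrite ler_pdivlMr// (ler_piMr (ltW N0) P1).
  by rewrite ler_ln ?posrE// (lt_le_trans L0).
rewrite log2_capacity -[P * _ / _]mulrA log2_capacity -/Cn log2_invD// lnV ?posrE// -/Dn.
move: root be LL; rewrite lz; clear.
move: (_ * invD p) (b * _) (F _) => x y f.
lra.
Qed.
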